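(* Assume that the Chowla conjecture holds for the Liouville function $\boldsymbol{\lambda}$. Then no topological dynamical system $(X,T)$ with positive topological entropy satisfies the strong MOMO property relatively to $\boldsymbol{\lambda}$.
   Context: $\boldsymbol{\lambda}(n)=(-1)^{\Omega(n)}$, where $\Omega(n)$ is the number of prime divisors of $n$ counted with multiplicity; put $\boldsymbol{\lambda}(0):=0$ in sums containing $n=0$ (immaterial). The Chowla conjecture for $\boldsymbol{\lambda}$ is the statement that the sequence $(\boldsymbol{\lambda}(n))_{n\ge1}$ is a generic point for the Bernoulli measure $B(1/2,1/2)$ (product of uniform measures on $\{-1,1\}$) for the shift on $\{-1,1\}^{\mathbb{N}}$; i.e. the empirical measures along its shift orbit converge weak-* to $B(1/2,1/2)$. A topological dynamical system $(X,T)$ is a compact metric space with a continuous map $T\colon X\to X$. Strong MOMO property of $(X,T)$ relatively to $\boldsymbol{\lambda}$: for every increasing sequence of integers $0=b_0<b_1<b_2<\cdots$ with $b_{k+1}-b_k\to\infty$, every sequence $(x_k)$ in $X$ and every $f\in C(X)$, $$\frac1{b_K}\sum_{k<K}\Bigl|\sum_{b_k\le n<b_{k+1}}f(T^{n-b_k}x_k)\boldsymbol{\lambda}(n)\Bigr|\to0\quad (K\to\infty).$$ *)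

(* Defs.v *)
From HB Require Import structures.
From mathcomp Require Import all_boot all_order all_algebra.
From mathcomp Require Import all_classical all_reals all_analysis.

Set Implicit Arguments.
Unset Strict Implicit.
Unset Printing Implicit Defensive.

Import Order.TTheory GRing.Theory Num.Theory.
Import numFieldTopology.Exports numFieldNormedType.Exports.

Local Open Scope classical_set_scope.
Local Open Scope ring_scope.

Definition prime_Omega (n : nat) : nat := (\sum_(p <- primes n) logn p n)%N.

Definition liouville (R : realType) (n : nat) : R :=
  if n == 0%N then 0 else (-1) ^+ prime_Omega n.

(* The space {-1,1}^N is represented by [cantor_space], the product topological
   space bool^nat: the boolean [b] stands for the sign [(-1) ^+ b], so that
   [false] is +1 and [true] is -1. *)
Definition sign_shift (x : cantor_space) : cantor_space := fun i => x i.+1.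

(* Coordinate [i] carries the value at [i + 1]: the sequence starts at 1. *)
Definition liouville_point : cantor_space := fun i => odd (prime_Omega i.+1).

Lemma liouville_pointE (R : realType) (i : nat) :
  (-1) ^+ liouville_point i = liouville R i.+1.
Proof. by rewrite /liouville /liouville_point signr_odd. Qed.

Notation borel_cantor :=
  (g_sigma_algebraType [set A : set cantor_space | open A]).

(* B(1/2,1/2), the product of the uniform measures, is the unique Borel
   probability measure giving mass 2^-n to every cylinder of length n. *)
Definition is_bernoulli_half (R : realType) (B : probability borel_cantor R) :=
  forall (n : nat) (w : nat -> bool),
    B [set x : borel_cantor | forall i, (i < n)%N -> x i = w i]
    = ((2 ^+ n)^-1)%:E.

(* [z] is generic for [mu]: the empirical measures
   (1/N) \sum_(n < N) \d_(S^n z) converge weak-* to [mu]. *)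
Definition generic_point (R : realType) (mu : probability borel_cantor R)
    (z : cantor_space) :=
  forall f : cantor_space -> R, continuous f ->
    (N%:R^-1 * \sum_(n < N) f (iter n sign_shift z)) @[N --> \oo]
      --> (\int[mu]_x f x)%R.

Definition chowla (R : realType) : Prop :=
  exists B : probability borel_cantor R,
    is_bernoulli_half B /\ generic_point B liouville_point.

Section dynamics.
Context (R : realType) (X : metricType R).
Implicit Type T : X -> X.

(* [s] lists the points of a finite (n, e)-separated set: distinct points are
   more than [e] apart for the Bowen metric max_(i < n) d(T^i x, T^i y). *)
Definition bowen_separated T (n : nat) (e : R) (s : seq X) : Prop :=
  uniq s /\
  {in s &, forall x y, x != y ->
     exists2 i, (i < n)%N & e < mdist (iter i T x) (iter i T y)}.

Definition separation_number T (n : nat) (e : R) : \bar R :=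
  ereal_sup [set ((size s)%:R)%:E | s in bowen_separated T n e].

Definition entropy_at_scale T (e : R) : \bar R :=
  limn_esup (fun n => (n%:R^-1)%:E * lne (separation_number T n e))%E.

(* Bowen's definition; [entropy_at_scale T e] increases as [e] decreases, so the
   limit as e -> 0+ is the supremum over e > 0. *)
Definition topological_entropy T : \bar R :=
  ereal_sup [set entropy_at_scale T e | e in [set e : R | 0 < e]].

Definition strong_MOMO_liouville T : Prop :=
  forall b : nat -> nat,
    b 0%N = 0%N ->
    {homo b : i j / (i < j)%N} ->
    (b k.+1 - b k)%N @[k --> \oo] --> \oo ->
  forall (x : nat -> X) (f : X -> R), continuous f ->
    ((b K)%:R^-1 *
      \sum_(k < K) `| \sum_(b k <= n < b k.+1)
                        f (iter (n - b k) T (x k)) * liouville R n |)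
      @[K --> \oo] --> (0 : R).

End dynamics.

(* Main.v *)
(* Code a point x by the partial word of length n recording where
   f(T^i x) >= a, where f(T^i x) <= -a, and forget the rest.
   If a set J of coordinates is shattered by these words, then for every sign
   word w one can choose a point x(w) following w on J and depending on w only
   through J; averaging over w, the correlation sum_i f(T^i x(w)) w_i is at
   least a|J|. Under Chowla a uniformly random w may be replaced by the blocks
   of the Liouville function, so strong MOMO forces |J| = o(n).
   A Sauer-Shelah argument for partial words then gives subexponentially many
   codes, up to compatibility: running through the coordinates, an unexpected
   symbol at least halves the number of shattered sets, so x is coded by a set
   of at most log_2 (number of shattered sets) = o(n) coordinates.
   With f ranging over the distances to the points of a finite net, equal codes
   imply closeness in the Bowen metric, and the entropy vanishes. *)

Require Import Defs.
From mathcomp Require Import all_boot all_order all_algebra.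
From mathcomp Require Import all_classical all_reals all_analysis.
From mathcomp Require Import lra.

Set Implicit Arguments.
Unset Strict Implicit.
Unset Printing Implicit Defensive.

Import Order.TTheory GRing.Theory Num.Theory.
Import numFieldTopology.Exports numFieldNormedType.Exports.

Local Open Scope classical_set_scope.
Local Open Scope ring_scope.

(** * Shattering and mistake sets of partial words *)

Section partial_words.
Context (X : Type) (n : nat) (s : X -> 'I_n -> option bool).
Implicit Types (Y : set X) (J : {set 'I_n}).

Definition shatters Y J : Prop :=
  forall w : {ffun 'I_n -> bool},
    exists2 y, Y y & forall j, j \in J -> s y j = Some (w j).

Definition shattered_sets Y : {set {set 'I_n}} := [set J | `[< shatters Y J >]].

Lemma shattered_setsP Y J : reflect (shatters Y J) (J \in shattered_sets Y).
Proof. by rewrite inE; exact: asboolP. Qed.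

Lemma shattersS Y Y' J : Y `<=` Y' -> shatters Y J -> shatters Y' J.
Proof. by move=> sYY' + w => /(_ w)[y /sYY' Yy yw]; exists y. Qed.

Lemma leq_card_shattered Y Y' :
  Y `<=` Y' -> (#|shattered_sets Y| <= #|shattered_sets Y'|)%N.
Proof.
move=> sYY'; apply/subset_leq_card/fintype.subsetP => J /shattered_setsP YJ.
exact/shattered_setsP/(shattersS sYY').
Qed.

(* A set shattered by both halves of [Y] cannot contain [i], and adding [i] to
   it gives a further set shattered by [Y]. *)
Lemma card_shattered_split Y (i : 'I_n) :
  (#|shattered_sets [set y | Y y /\ s y i = Some true]| +
   #|shattered_sets [set y | Y y /\ s y i = Some false]|
   <= #|shattered_sets Y|)%N.
Proof.
set A := shattered_sets [set y | _]; set B := shattered_sets [set y | _].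
have notin b J : shatters [set y | Y y /\ s y i = Some b] J -> i \notin J.
  move=> sJ; apply/negP => iJ.
  have [y [_ yb] /(_ _ iJ)] := sJ [ffun=> ~~ b].
  by rewrite yb ffunE => -[]; case: (b).
have inA J : J \in A -> i \notin J by move/shattered_setsP/notin.
have inB J : J \in B -> i \notin J by move/shattered_setsP/notin.
have injU : {in A :&: B &, injective (fun J => i |: J)}.
  move=> J J' /setIP[/inA iJ _] /setIP[/inA iJ' _] /(congr1 (fun J => J :\ i)).
  by rewrite !setU1K.
rewrite -cardsUI -(card_in_imset injU) -cardsUI.
rewrite [X in (_ + X)%N](_ : _ = 0%N) ?addn0; last first.
  apply/eqP; rewrite cards_eq0 -finset.subset0; apply/fintype.subsetP.
  move=> J /setIP[JAB /imsetP[K _ defJ]].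
  have : i \in J by rewrite defJ setU11.
  by case/setUP: JAB => [/inA|/inB] /negPf ->.
apply/subset_leq_card/fintype.subsetP => J /setUP[/setUP[]|/imsetP[K]].
- by move/shattered_setsP => sJ; apply/shattered_setsP/(shattersS _ sJ) => y [].
- by move/shattered_setsP => sJ; apply/shattered_setsP/(shattersS _ sJ) => y [].
move=> /setIP[/shattered_setsP sA /shattered_setsP sB] ->.
apply/shattered_setsP => w.
have [y [Yy yi] yw] : exists2 y, Y y /\ s y i = Some (w i) &
    forall j, j \in K -> s y j = Some (w j).
  by case: (w i); [exact: sA | exact: sB].
by exists y => // j /setU1P[->|/yw].
Qed.

(** An undefined symbol is compatible with everything, so this relation need not be transitive. *)
Definition agree (y y' : X) (i : 'I_n) : Prop :=
  forall b b', s y i = Some b -> s y' i = Some b' -> b = b'.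

(* [E y] records the coordinates at which [y] takes the symbol with fewer
   shattered sets; each of them at least halves the number of shattered sets. *)
Lemma mistake_sets (l : seq 'I_n) Y : uniq l ->
  exists E : X -> {set 'I_n},
    (forall y, Y y -> {subset E y <= l} /\ (2 ^ #|E y| <= #|shattered_sets Y|)%N) /\
    (forall y y', Y y -> Y y' -> E y = E y' -> forall i, i \in l -> agree y y' i).
Proof.
elim: l Y => [|i l IHl] Y /= => [_|/andP[il ul]].
  exists (fun=> finset.set0); split=> // y Yy; split=> [j|]; first by rewrite inE.
  rewrite cards0 expn0 card_gt0; apply/set0Pn; exists finset.set0.
  by apply/shattered_setsP => w; exists y => // j; rewrite inE.
pose H b := [set y | Y y /\ s y i = Some b].
have [b le_b] : exists b,
    (#|shattered_sets (H b)|.*2 <= #|shattered_sets Y|)%N.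
  have := card_shattered_split Y i; rewrite -/(H true) -/(H false).
  move=> tot; case: (leqP #|shattered_sets (H true)| #|shattered_sets (H false)|) => [le|/ltnW le].
    by exists true; rewrite -addnn; apply: leq_trans tot; rewrite leq_add2l.
  by exists false; rewrite -addnn; apply: leq_trans tot; rewrite leq_add2r.
have [E1 [E1l E1a]] := IHl (H b) ul.
have [E2 [E2l E2a]] := IHl (Y `\` H b) ul.
have dec y : Y y -> H b y \/ (Y `\` H b) y.
  by move=> Yy; have [?|?] := pselect (H b y); [left|right].
have in1 y (hy : H b y) : i \notin E1 y.
  by apply: contra il => /(E1l _ hy).1.
have in2 y (hy : (Y `\` H b) y) : i \notin E2 y.
  by apply: contra il => /(E2l _ hy).1.
(* Only the symbol [b] counts as a mistake; points with the other symbol or with none at [i]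
   continue together. *)
exists (fun y => if `[< H b y >] then i |: E1 y else E2 y); split.
  move=> y /dec[hy|hy].
    rewrite asboolT //; have [sE cE] := E1l _ hy; split.
      by move=> j /setU1P[->|/sE jl]; rewrite inE ?eqxx // jl orbT.
    rewrite cardsU1 in1 // add1n expnS mul2n (leq_trans _ le_b) //.
    by rewrite leq_double.
  rewrite asboolF; last exact: hy.2.
  have [sE cE] := E2l _ hy; split; first by move=> j /sE jl; rewrite inE jl orbT.
  by apply: (leq_trans cE); apply: leq_card_shattered => z [].
move=> y y' /dec[hy|hy] /dec[hy'|hy'].
- rewrite !asboolT // => eqE j; rewrite inE => /orP[/eqP->|jl].
    by rewrite /agree hy.2 hy'.2 => ? ? [<-] [<-].
  apply: (E1a) jl => //.
  by rewrite -(setU1K (in1 _ hy)) eqE setU1K // in1.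
- rewrite (asboolT hy) (asboolF hy'.2) => eqE.
  by have := in2 _ hy'; rewrite -eqE setU11.
- rewrite (asboolT hy') (asboolF hy.2) => eqE.
  by have := in2 _ hy; rewrite eqE setU11.
- rewrite !asboolF; [|exact: hy'.2|exact: hy.2] => eqE j.
  rewrite inE => /orP[/eqP->|jl]; last exact: (E2a) jl.
  (* Off [H b] the only symbol that can be defined at [i] is [~~ b]. *)
  have key z c : (Y `\` H b) z -> s z i = Some c -> c = ~~ b.
    move=> [Yz nHz] zc; case: (eqVneq c b) => [cb|]; last by case: (c); case: (b).
    by case: nHz; split=> //; rewrite zc cb.
  by move=> c c' /(key _ _ hy) -> /(key _ _ hy') ->.
Qed.

End partial_words.

(** * Correlations of orbits with uniformly random sign words *)

Definition sign_word (R : realType) (X : Type) (T : X -> X) (f : X -> R) (a : R)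
    (n : nat) (x : X) (i : 'I_n) : option bool :=
  if a <= f (iter i T x) then Some false
  else if f (iter i T x) <= - a then Some true else None.

Definition correlation (R : realType) (X : Type) (T : X -> X) (f : X -> R)
    (n : nat) (w : {ffun 'I_n -> bool}) (x : X) : R :=
  \sum_(i < n) f (iter i T x) * (-1) ^+ w i.

(** Flipping coordinate [i] is an involution on words that preserves [h] and reverses the sign. *)
Lemma sum_signed_eq0 (R : realType) (n : nat) (i : 'I_n)
    (h : {ffun 'I_n -> bool} -> R) :
  (forall w w' : {ffun 'I_n -> bool}, (forall j, j != i -> w j = w' j) -> h w = h w') ->
  \sum_(w : {ffun 'I_n -> bool}) h w * (-1) ^+ w i = 0.
Proof.
move=> h_i.
pose flip (w : {ffun 'I_n -> bool}) : {ffun 'I_n -> bool} :=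
  [ffun j => (j == i) (+) w j].
have flipK : involutive flip.
  by move=> w; apply/ffunP => j; rewrite !ffunE addbA addbb.
suff eqN : \sum_w h w * (-1) ^+ w i = - \sum_(w : {ffun 'I_n -> bool}) h w * (-1) ^+ w i.
  lra.
rewrite {1}(reindex_inj (inv_inj flipK)) -sumrN; apply: eq_bigr => w _.
rewrite !ffunE eqxx signr_addb mulN1r mulrN; congr (- (_ * _)).
by apply: h_i => j /negPf ji; rewrite ffunE ji.
Qed.

(* Choosing [x w] from the restriction of [w] to [J], the coordinates outside
   [J] average out. *)
Lemma shattered_correlation (R : realType) (X : Type) (T : X -> X) (f : X -> R)
    (a : R) (n : nat) (J : {set 'I_n}) :
  shatters (@sign_word R X T f a n) setT J ->
  exists x : {ffun 'I_n -> bool} -> X,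
    a * #|J|%:R * 2 ^+ n <= \sum_w correlation T f w (x w).
Proof.
move=> /(_ _)/cid2-/all_sig2[y _ yJ].
pose r (w : {ffun 'I_n -> bool}) : {ffun 'I_n -> bool} := [ffun j => (j \in J) && w j].
exists (fun w => y (r w)).
rewrite /correlation exchange_big /= (bigID (mem J)) /= [X in _ + X]big1 ?addr0.
  rewrite -sum1_card natr_sum mulr_sumr mulr_suml; apply: ler_sum => i iJ.
  rewrite mulr1.
  have -> : a * 2 ^+ n = \sum_(w : {ffun 'I_n -> bool}) a.
    by rewrite sumr_const card_ffun card_bool card_ord -[RHS]mulr_natr natrX.
  apply: ler_sum => w _; have := yJ (r w) i iJ; rewrite /sign_word ffunE iJ /=.
  case: ifP => [ha [<-]|_]; first by rewrite expr0 mulr1.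
  by case: ifP => // ha [<-]; rewrite expr1 mulrN1 lerNr.
move=> i iJ; apply: sum_signed_eq0 => w w' ww'.
rewrite (_ : r w = r w') //; apply/ffunP => j; rewrite !ffunE.
by case: (eqVneq j i) => [->|/ww' -> //]; rewrite (negPf iJ).
Qed.

(** * Averages of cylinder functions along the Liouville sequence *)

Definition prefix_word (n : nat) (z : cantor_space) : {ffun 'I_n -> bool} :=
  [ffun i : 'I_n => z i].

Lemma near_prefix_word (n : nat) (z : cantor_space) :
  \forall z' \near z, prefix_word n z' = prefix_word n z.
Proof.
have : nbhs z [set z' : cantor_space | forall i : 'I_n, z' i = z i].
  apply: (@filter_forall _ 'I_n (fun i => [set z' : cantor_space | z' i = z i])
    _ (nbhs_filter z)) => i.
  exact: (@proj_continuous nat (fun=> bool) i z _ (discrete_set1 (z i))).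
by apply: filterS => z' zz'; apply/ffunP => i; rewrite !ffunE zz'.
Qed.

Lemma measurable_cylinder (n : nat) (w : {ffun 'I_n -> bool}) :
  measurable ([set z | prefix_word n z = w] : set borel_cantor).
Proof.
apply: sub_sigma_algebra; rewrite /= openE => z <-.
exact: near_prefix_word.
Qed.

Lemma bernoulli_cylinder (R : realType) (B : probability borel_cantor R)
    (n : nat) (w : {ffun 'I_n -> bool}) :
  is_bernoulli_half B -> B [set z | prefix_word n z = w] = (2 ^- n)%:E.
Proof.
(* The padding value [false] beyond [n] is never tested by the cylinder. *)
move=> /(_ n (fun i => oapp w false (insub i))) <-.
congr (B _); apply/seteqP; split=> z /= => [<- i ltin|zw].
  by rewrite insubT /= ffunE.
by apply/ffunP => i; rewrite ffunE zw // valK.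
Qed.

Lemma integral_prefix_word (R : realType) (B : probability borel_cantor R)
    (n : nat) (G : {ffun 'I_n -> bool} -> R) :
  is_bernoulli_half B ->
  (\int[B]_z G (prefix_word n z))%R = 2 ^- n * \sum_w G w.
Proof.
move=> hB; pose C w : set borel_cantor := [set z | prefix_word n z = w].
have GE z : (G (prefix_word n z))%:E =
    (\sum_w (G w)%:E * (\1_(C w) z)%:E)%E.
  rewrite (bigD1 (prefix_word n z)) //= big1 ?adde0.
    by rewrite indicE mem_set // mule1.
  by move=> w wz; rewrite indicE memNset ?mule0 // => zw; rewrite /C /= zw eqxx in wz.
rewrite /Rintegral; under eq_integral do rewrite GE.
have intC w : B.-integrable setT (fun z => (\1_(C w) z)%:E).
  by apply: integrable_indic; exact: measurable_cylinder.
rewrite integral_sum //; last by move=> w; apply: integrableZl.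
rewrite (eq_bigr (fun w => (G w * 2 ^- n)%:E)) => [|w _].
  by rewrite sumEFin /= -mulr_suml mulrC.
rewrite integralZl // integral_indic //; last exact: measurable_cylinder.
by rewrite setIT EFinM; congr (_ * _)%E; exact: bernoulli_cylinder.
Qed.

Lemma iter_sign_shift (t i : nat) (z : cantor_space) :
  iter t sign_shift z i = z (t + i)%N.
Proof. by elim: t i => //= t IH i; rewrite /sign_shift IH addSnnS. Qed.

(** The signs of the Liouville function at [t + 1, ..., t + n], since [liouville_point] starts at
    1. *)
Definition liouville_word (n t : nat) : {ffun 'I_n -> bool} :=
  [ffun i : 'I_n => liouville_point (t + i)%N].

(** A function of the first [n] coordinates is locally constant, hence an admissible test function
    for genericity. *)
Lemma chowla_average (R : realType) (n : nat) (G : {ffun 'I_n -> bool} -> R) :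
  chowla R ->
  (N%:R^-1 * \sum_(t < N) G (liouville_word n t)) @[N --> \oo]
    --> 2 ^- n * \sum_w G w.
Proof.
move=> [B [hB gB]]; rewrite -(integral_prefix_word G hB).
have cG : continuous (fun z : cantor_space => G (prefix_word n z)).
  move=> z; apply: (near_cst_continuous (G (prefix_word n z))).
  by apply: filterS (near_prefix_word n z) => z' ->.
suff <- : (fun N : nat => N%:R^-1 * \sum_(t < N)
    G (prefix_word n (iter t sign_shift liouville_point)) : R)
  = (fun N => N%:R^-1 * \sum_(t < N) G (liouville_word n t)) by exact: gB.
apply/funext => N; congr (_ * _); apply: eq_bigr => t _; congr G.
by apply/ffunP => i; rewrite !ffunE iter_sign_shift.
Qed.

(** * Long blocks along one residue class, and their concatenation *)

Lemma sum_residues (V : nmodType) (h : nat -> V) (n q : nat) :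
  \sum_(t < q * n) h t = \sum_(o < n) \sum_(l < q) h (o + l * n)%N.
Proof.
elim: q => [|q IHq].
  by rewrite mul0n big_ord0 big1 // => o _; rewrite big_ord0.
rewrite mulSnr big_split_ord /= IHq -big_split /=.
by apply: eq_bigr => o _; rewrite big_ord_recr /= addnC.
Qed.

(** Pigeonhole over the residues mod [n]. The loss from [c] to [c / 2] pays for the discarded first
    [b] terms and the extra length [K], both negligible once [q] is large. *)
Lemma average_residue (R : realType) (g : nat -> R) (c L : R) (n b K : nat) :
  0 < c -> (0 < n)%N -> c * n%:R <= L ->
  (N%:R^-1 * \sum_(t < N) g t) @[N --> \oo] --> L ->
  exists o q, (o < n)%N /\
    c / 2 * (b + K + q * n)%:R <= \sum_(l < q) g (b + o + l * n)%N.
Proof.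
move=> c0 n0 cL gL.
have n0R : 0 < n%:R :> R by rewrite ltr0n.
have /(cvgr_gt _ gL) [M _ hM] : 3 / 4 * (c * n%:R) < L.
  apply: lt_le_trans cL; have : 0 < c * n%:R by exact: mulr_gt0.
  lra.
pose S := \sum_(t < b) g t.
(* For [q > y] the quarter of [c * n] between the lower bound 3/4 and the target 1/2 covers [S] and
   [K]. *)
pose y := 4 * (S + c / 2 * n%:R * K%:R) / (c * n%:R).
pose q0 := Num.bound `|y|.
have hq0 : y < q0%:R by apply: le_lt_trans (ler_norm y) (archi_boundP _).
pose q := maxn q0 M.+1.
have big_q : S + c / 2 * n%:R * (b + K + q * n)%:R <= \sum_(t < b + q * n) g t.
  have leqN : (q <= b + q * n)%N by rewrite (leq_trans (leq_pmulr q n0)) ?leq_addl.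
  have /hM : (M <= b + q * n)%N by rewrite (leq_trans _ leqN) // /q leq_max leqnSn orbT.
  have N0 : 0 < (b + q * n)%:R :> R.
    by rewrite ltr0n (leq_trans _ leqN) // /q leq_max orbT.
  rewrite /= -ltr_pdivrMl ?invr_gt0 // invrK => hS.
  have hq : 4 * (S + c / 2 * n%:R * K%:R) < (c * n%:R) * (b + q * n)%:R.
    rewrite -ltr_pdivrMl ?mulr_gt0 // mulrC (lt_le_trans hq0) // ler_nat.
    by rewrite (leq_trans _ leqN) // leq_maxl.
  apply: ltW; apply: le_lt_trans hS.
  rewrite -addnA (addnC K) addnA natrD mulrDr.
  lra.
apply: contrapT => none.
have : \sum_(o < n) \sum_(l < q) g (b + o + l * n)%N <
       \sum_(o < n) c / 2 * (b + K + q * n)%:R.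
  apply: ltr_sum; first by apply/hasP; exists (Ordinal n0); rewrite ?mem_index_enum.
  by move=> o _; rewrite ltNge; apply/negP => ho; apply: none; exists o, q.
rewrite sumr_const card_ord; apply/negP; rewrite -leNgt.
rewrite (eq_bigr (fun o : 'I_n => \sum_(l < q) g (b + (o + l * n))%N)); last first.
  by move=> o _; apply: eq_bigr => l _; rewrite addnA.
rewrite -(sum_residues (fun t => g (b + t)%N)).
move: big_q; rewrite big_split_ord /= lerD2l; apply: le_trans.
by rewrite -[leLHS]mulr_natr; lra.
Qed.

(* Stage [N], entered at position [B], consists of one block of length [o N B]
   followed by [q N B] blocks of length [n N B]; a state [(N, B, l)] is the
   [l]-th block of that stage. *)
Section stages.
Context (n o q : nat -> nat -> nat).
Implicit Type s : nat * nat * nat.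

Definition block_start s : nat :=
  let: (N, B, l) := s in if l is l'.+1 then B + o N B + l' * n N B else B.

Definition block_size s : nat :=
  let: (N, B, l) := s in if l is _.+1 then n N B else o N B.

Definition next_block s : nat * nat * nat :=
  let: (N, B, l) := s in
  if (l < q N B)%N then (N, B, l.+1) else (N.+1, B + o N B + q N B * n N B, 0)%N.

Definition nth_block k := iter k next_block (0, 0, 0)%N.

Definition block_bound k := block_start (nth_block k).

Lemma block_startS s : (s.2 <= q s.1.1 s.1.2)%N ->
  block_start (next_block s) = (block_start s + block_size s)%N.
Proof.
case: s => -[N B] l /= lq; case: ltnP => [_|ql] /=.
  by case: l lq => [|l] _ /=; rewrite ?mul0n ?addn0 // mulSnr addnA.
have -> : q N B = l by apply/eqP; rewrite eqn_leq lq ql.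
by case: l {lq ql} => [|l] /=; rewrite ?mul0n ?addn0 // mulSnr addnA.
Qed.

Lemma nth_block_le k :
  ((nth_block k).2 <= q (nth_block k).1.1 (nth_block k).1.2)%N.
Proof.
elim: k => //= k; case: (nth_block k) => -[N B] l /= _.
by case: ltnP.
Qed.

Lemma block_boundS k :
  block_bound k.+1 = (block_bound k + block_size (nth_block k))%N.
Proof. exact: block_startS (nth_block_le k). Qed.

Lemma leq_stage k k' :
  (k <= k')%N -> ((nth_block k).1.1 <= (nth_block k').1.1)%N.
Proof.
elim: k' => [|k' IH]; first by rewrite leqn0 => /eqP ->.
rewrite leq_eqVlt => /predU1P[-> //|/IH /leq_trans]; apply => /=.
by case: (nth_block k') => -[N B] l /=; case: ltnP.
Qed.

Lemma nth_block_add k N B l : nth_block k = (N, B, 0)%N -> (l <= q N B)%N ->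
  nth_block (k + l) = (N, B, l).
Proof.
move=> kE; elim: l => [|l IHl] lq; first by rewrite addn0.
by rewrite addnS /= IHl ?(ltnW lq) //= lq.
Qed.

Lemma nth_block_end k N B : nth_block k = (N, B, 0)%N ->
  nth_block (k + q N B).+1 = (N.+1, B + o N B + q N B * n N B, 0)%N.
Proof. by move=> /nth_block_add /(_ (leqnn _)) /= ->; rewrite /= ltnn. Qed.

Lemma stage_start N : exists k B, (N <= k)%N /\ nth_block k = (N, B, 0)%N.
Proof.
elim: N => [|N [k [B [Nk kE]]]]; first by exists 0%N, 0%N.
exists (k + q N B).+1, (B + o N B + q N B * n N B)%N; split.
  by rewrite ltnS (leq_trans Nk) // leq_addr.
exact: nth_block_end.
Qed.

End stages.

Lemma concat_stages (R : realType) (X : Type) (W : nat -> nat -> X -> R) (c : R) :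
  (forall b b' x, 0 <= W b b' x) ->
  (forall N B, exists n o q (y : nat -> X), [/\ (N < n)%N, (n <= o)%N &
     c * (B + o + q * n)%:R <=
     \sum_(l < q) W (B + o + l * n)%N (B + o + l * n + n)%N (y l)]) ->
  exists (b : nat -> nat) (x : nat -> X),
    [/\ b 0%N = 0%N, {homo b : i j / (i < j)%N},
        (b k.+1 - b k)%N @[k --> \oo] --> \oo &
        forall K0, exists K, [/\ (K0 <= K)%N, (0 < b K)%N &
          c * (b K)%:R <= \sum_(k < K) W (b k) (b k.+1) (x k)]].
Proof.
move=> W0 H.
have [n1 H1] := choice (fun s : nat * nat => H s.1 s.2).
have [ o1 H2] := choice H1; have [q1 H3] := choice H2; have [y1 H4] := choice H3.
pose n N B := n1 (N, B); pose o N B := o1 (N, B); pose q N B := q1 (N, B).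
pose y N B := y1 (N, B).
have H' N B : [/\ (N < n N B)%N, (n N B <= o N B)%N &
     c * (B + o N B + q N B * n N B)%:R <=
     \sum_(l < q N B) W (B + o N B + l * n N B)%N
       (B + o N B + l * n N B + n N B)%N (y N B l)] := H4 (N, B).
pose st := nth_block n o q; pose b := block_bound n o q.
(* Main block [l] is state [l.+1]; the connecting block, state 0, gets an arbitrary point. *)
exists b, (fun k => y (st k).1.1 (st k).1.2 (st k).2.-1).
have size_gt k : ((st k).1.1 < block_size n o (st k))%N.
  case: (st k) => -[N B] [|l] /=; have [Nn no _] := H' N B => //.
  exact: leq_trans no.
have bS k : b k.+1 = (b k + block_size n o (st k))%N := block_boundS n o q k.
have b_lt : {homo b : i j / (i < j)%N}.
  apply: homo_ltn => [? ? ?|k]; first exact: ltn_trans.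
  by rewrite bS -[ltnLHS]addn0 ltn_add2l (leq_ltn_trans _ (size_gt k)).
split => //.
  apply/cvgnyPge => A; have [k [B [_ kE]]] := stage_start n o q A.
  exists k => // k' /= kk'; rewrite bS addKn ltnW // (leq_ltn_trans _ (size_gt k')) //.
  by have := leq_stage n o q kk'; rewrite -/(st k') kE.
move=> K0; have [k [B [K0k kE]]] := stage_start n o q K0.
(* The index at which stage [K0] has just ended. *)
exists (k + q K0 B).+1; split.
- by rewrite (leq_trans K0k) // leqW // leq_addr.
- by have := b_lt 0%N (k + q K0 B).+1 isT; apply: leq_ltn_trans.
have [_ _] := H' K0 B.
rewrite {1}/b /block_bound (nth_block_end kE) /= => /le_trans; apply.
rewrite -addnS big_split_ord /= big_ord_recl /= addrA.
rewrite -[leLHS]add0r lerD //; first by rewrite addr_ge0 ?sumr_ge0.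
apply: ler_sum => l _; rewrite bS /b /block_bound /st /bump leq0n add1n.
by rewrite (nth_block_add kE (ltn_ord l)).
Qed.

(** * Strong MOMO bounds correlations with random words *)

Section momo.
Context (R : realType) (X : metricType R) (T : X -> X) (f : X -> R).

Definition block_weight (b b' : nat) (x : X) : R :=
  `| \sum_(b <= m < b') f (iter (m - b) T x) * liouville R m |.

Lemma correlation_le_block_weight (n t : nat) (x : X) :
  correlation T f (liouville_word n t) x <= block_weight t.+1 (t.+1 + n) x.
Proof.
apply: le_trans (ler_norm _); rewrite (@big_addn _ _ _ 0 _ t.+1) addKn big_mkord.
rewrite le_eqVlt; apply/orP; left; apply/eqP; apply: eq_bigr => i _.
by rewrite ffunE liouville_pointE addnK addnS addnC.
Qed.

Lemma stage_exists (c : R) (n : nat) (x : {ffun 'I_n -> bool} -> X) (B : nat) :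
  chowla R -> 0 < c -> (0 < n)%N ->
  c * n%:R * 2 ^+ n <= \sum_w correlation T f w (x w) ->
  exists o q (y : nat -> X), (n <= o)%N /\
    c / 2 * (B + o + q * n)%:R <=
    \sum_(l < q) block_weight (B + o + l * n) (B + o + l * n + n) (y l).
Proof.
move=> hC c0 n0 hx.
pose g t := correlation T f (liouville_word n t) (x (liouville_word n t)).
have gL := @chowla_average R n (fun w => correlation T f w (x w)) hC.
have cL : c * n%:R <= 2 ^- n * \sum_w correlation T f w (x w).
  by rewrite ler_pdivlMl ?exprn_gt0 // mulrC.
(* The word at [t] is read from [t + 1] on, so the offset [n.-1] turns into a connecting block of
   length [n + r]; as [r < n], the slack [n.+1] covers its length. *)
have [r [q [rn hr]]] :=
  @average_residue R g c _ n (B + n.-1) n.+1 c0 n0 cL gL.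
exists (n + r)%N, q, (fun l => x (liouville_word n (B + n.-1 + r + l * n))).
split; first exact: leq_addr.
apply: le_trans (le_trans hr _); last first.
  apply: ler_sum => l _; apply: le_trans (correlation_le_block_weight _ _ _) _.
  have -> : (B + n.-1 + r + l * n).+1 = (B + (n + r) + l * n)%N.
    by case: (n) n0 => // m _; rewrite /= !addnS !addSn !addnA.
  by [].
rewrite ler_pM2l ?divr_gt0 // ler_nat leq_add2r.
by rewrite -!addnA leq_add2l addnS -addSn prednK // leq_add2l ltnW.
Qed.

(** Otherwise arbitrarily large [n] admit highly correlated choices of points; each supplies a
    stage, and the concatenation keeps the MOMO averages at least [c / 2] infinitely often. *)
Lemma momo_correlation (c : R) :
  chowla R -> continuous f -> strong_MOMO_liouville T -> 0 < c ->
  exists n0, forall n, (n0 <= n)%N -> forall x : {ffun 'I_n -> bool} -> X,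
    \sum_w correlation T f w (x w) < c * n%:R * 2 ^+ n.
Proof.
move=> hC cf hM c0; apply: contrapT => H.
have c20 : 0 < c / 2 by exact: divr_gt0.
have [|//|b [x [b0 b_lt b_oo hb]]] := @concat_stages R X block_weight (c / 2).
- by move=> *; exact: normr_ge0.
- move=> N B; apply: contrapT => none; apply: H; exists N.+1 => n Nn x.
  rewrite ltNge; apply/negP => /(stage_exists B hC c0 (leq_ltn_trans (leq0n N) Nn)).
  by move=> [ o [q [y [no hy]]]]; apply: none; exists n, o, q, y.
have /cvgrPdist_lt/(_ _ c20)[K0 _ hK0] := hM b b0 b_lt b_oo x f cf.
have [K [/hK0 + bK0 hK]] := hb K0.
rewrite /= sub0r normrN; apply/negP; rewrite -leNgt.
apply: le_trans (ler_norm _); rewrite ler_pdivlMl ?ltr0n //.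
by rewrite mulrC.
Qed.

End momo.

(** * Counting codes *)

(** Chernoff bound: weigh [J] by [t ^+ #|J|]. The total weight is [(1 + t) ^+ n], and each small set
    weighs at least [expR (- (eta / 2 * n))]. *)
Lemma card_small_sets (R : realType) (eta : R) : 0 < eta ->
  exists2 c : R, 0 < c & forall n (A : {set {set 'I_n}}),
    (forall J, J \in A -> #|J|%:R <= c * n%:R) -> #|A|%:R <= expR (eta * n%:R).
Proof.
move=> eta0; pose u := 2 / eta; pose t := expR (- u).
have u0 : 0 < u by exact: divr_gt0.
have t_le : t <= eta / 2.
  rewrite /t expRN -[leRHS]invrK lef_pV2 ?posrE ?expR_gt0 ?invr_gt0 ?divr_gt0 //.
  rewrite invf_div -/u; apply: le_trans (expR_ge1Dx u); lra.
exists (eta / 2 / u) => [|n A smallA]; first by rewrite !divr_gt0.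
have sumt : \sum_(J : {set 'I_n}) t ^+ #|J| = (t + 1) ^+ n.
  transitivity (\prod_(i < n) (t + 1)); last by rewrite prodr_const card_ord.
  rewrite bigA_distr; apply: eq_bigr => J _.
  by rewrite -big_mkcond prodr_const.
have -> : expR (eta * n%:R) = expR (eta / 2 * n%:R) * expR (eta / 2) ^+ n.
  by rewrite -expRM_natr -expRD; congr expR; lra.
apply: (@le_trans _ _ (expR (eta / 2 * n%:R) * \sum_(J : {set 'I_n}) t ^+ #|J|)).
  rewrite -sum1_card natr_sum mulr_sumr [leRHS](bigID (mem A)) /= -[leLHS]addr0.
  apply: lerD; last first.
    by apply: sumr_ge0 => J _; rewrite mulr_ge0 ?exprn_ge0 ?expR_ge0.
  apply: ler_sum => J /smallA; rewrite /t -expRM_natr -expRD => hJ.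
  rewrite -[leLHS]expR0 ler_expR mulNr subr_ge0.
  have -> : eta / 2 * n%:R = u * (eta / 2 / u * n%:R).
    by rewrite mulrA mulrCA divff ?gt_eqF // mulr1.
  by rewrite ler_pM2l.
rewrite sumt ler_pM2l ?expR_gt0 // lerXn2r ?nnegrE ?expR_ge0 //.
  by rewrite addr_ge0 ?expR_ge0.
by apply: le_trans (expR_ge1Dx _); lra.
Qed.

Section complexity.
Context (R : realType) (X : metricType R) (T : X -> X).

(** Small sets are counted twice: shattered sets have size at most [c2 * n], so there are at most
    [2 ^ (c1 * n)] of them; mistake sets then have size at most [c1 * n], so there are few of these
    too. *)
Lemma symbolic_complexity (f : X -> R) (a eta : R) :
  chowla R -> strong_MOMO_liouville T -> continuous f -> 0 < a -> 0 < eta ->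
  exists n0, forall n, (n0 <= n)%N ->
    exists (A : {set {set 'I_n}}) (E : X -> {set 'I_n}),
      [/\ #|A|%:R <= expR (eta * n%:R), forall x, E x \in A &
        forall x y, E x = E y -> forall i, agree (@sign_word R X T f a n) x y i].
Proof.
move=> hC hM cf a0 eta0.
have [c1 c10 small1] := card_small_sets eta0.
have ln20 : 0 < ln 2 :> R by rewrite ln_gt0 // ltr1n.
have [c2 c20 small2] := card_small_sets (mulr_gt0 c10 ln20).
have [n0 hn0] := momo_correlation hC cf hM (mulr_gt0 a0 c20).
exists n0 => n n0n.
have [E [hE Eagree]] :=
  mistake_sets (@sign_word R X T f a n) setT (enum_uniq 'I_n).
exists (finset (fun J : {set 'I_n} => #|J|%:R <= c1 * n%:R)), E; split.
- by apply: small1 => J; rewrite inE.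
- move=> x; rewrite inE.
  have card_sh : #|shattered_sets (@sign_word R X T f a n) setT|%:R
      <= expR (c1 * ln 2 * n%:R) :> R.
    apply: small2 => J /shattered_setsP/shattered_correlation[y hy].
    have := le_lt_trans hy (hn0 n n0n y).
    by rewrite ltr_pM2r ?exprn_gt0 // -mulrA ltr_pM2l // => /ltW.
  have [_ hEx] := hE x I.
  move: hEx; rewrite -(ler_nat R) => /le_trans /(_ card_sh).
  rewrite natrX -[2 in leLHS]lnK ?posrE // -expRM_natr ler_expR.
  by rewrite mulrAC [leLHS]mulrC ler_pM2r.
by move=> x y Exy i; apply: Eagree => //; rewrite mem_enum.
Qed.

Lemma continuous_mdist (p : X) : continuous (fun x => mdist p x).
Proof.
move=> x; apply/cvgrPdist_lt => e e0.
have := nbhsx_ballx x e e0; rewrite ballEmdist.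
apply: filterS => y /= xy; apply: le_lt_trans xy.
rewrite ler_norml; have := metric_triangle p x y; have := metric_triangle p y x.
rewrite (metric_sym y x); lra.
Qed.

Lemma finite_net (e : R) : compact [set: X] -> 0 < e ->
  exists ps : seq X, forall x, exists2 p, p \in ps & mdist p x < e.
Proof.
move=> /compact_near_coveringP cX e0.
(* Lists directed by inclusion: the near-covering form of compactness then gives one list for all
   points. *)
pose F := filter_from [set: seq X] (fun ps0 => [set ps : seq X | {subset ps0 <= ps}]).
have FF : Filter F.
  apply: filter_from_filter; first by exists nil.
  move=> ps qs _ _; exists (ps ++ qs) => // rs /= sub.
  by split=> p pin; apply: sub; rewrite mem_cat pin ?orbT.
have [|ps _ sub] := cX _ F (fun ps x => exists2 p, p \in ps & mdist p x < e) FF.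
  move=> x _; exists (ball x e, [set ps : seq X | {subset [:: x] <= ps}]) => /=.
    by split; [exact: nbhsx_ballx | exists [:: x]].
  move=> [y ps] /= [+ sub]; rewrite ballEmdist /= => xy; exists x => //.
  by apply: sub; rewrite mem_head.
by exists ps => x; exact: sub.
Qed.

End complexity.

(** * Separated sets and entropy *)

Section entropy.
Context (R : realType) (X : metricType R) (T : X -> X).
Context (hC : chowla R) (hM : strong_MOMO_liouville T).
Context (cX : compact [set: X]).

Lemma size_bowen_separated (e delta : R) : 0 < e -> 0 < delta ->
  exists n0, forall n, (n0 <= n)%N -> forall s : seq X,
    bowen_separated T n e s -> (size s)%:R <= expR (delta * n%:R).
Proof.
move=> e0 delta0.
have [ps net] := finite_net cX (divr_gt0 e0 (ltr0n R 8)).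
(* The [m] codes together cost [m * eta <= delta]; the successor avoids dividing by zero. *)
pose m := size ps; pose eta := delta / m.+1%:R.
have eta0 : 0 < eta by rewrite divr_gt0 // ltr0n.
(* [5/16 * e] is the midpoint of [e / 8, e / 2] and [3/16 * e] half its length:
   the sign word of [f j] tells the points within [e / 8] of the [j]-th net point
   from those at distance at least [e / 2]. *)
pose a := 3 / 16 * e; have a0 : 0 < a by rewrite /a; lra.
pose f (j : 'I_m) (x : X) : R := mdist (tnth (in_tuple ps) j) x - 5 / 16 * e.
have cf j : continuous (f j).
  by move=> x; apply: cvgB; [exact: continuous_mdist | exact: cvg_cst].
have [n0 hn0] := choice (fun j => symbolic_complexity hC hM (cf j) a0 eta0).
exists (\max_j n0 j) => n n0n s [us sep].
have hj j : (n0 j <= n)%N by apply: leq_trans n0n; exact: leq_bigmax.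
have [A hA] := choice (fun j => hn0 j n (hj j)).
have [E hE] := choice hA.
pose code x := [ffun j => E j x].
have inj_code : {in s &, injective code}.
  move=> x y xs ys /ffunP exy; apply/eqP; apply: contraT => xy.
  have [i lt_in] := sep x y xs ys xy.
  rewrite ltNge => /negP[]; apply/ltW.
  have [p pps px] := net (iter i T x).
  have jP : (index p ps < m)%N by rewrite index_mem.
  pose j := Ordinal jP.
  have jE : tnth (in_tuple ps) j = p by rewrite (tnth_nth p) /= nth_index.
  have := exy j; rewrite !ffunE; have [_ _ hagree] := hE j.
  (* The symbol of [x] is [true], so that of [y] is not [false]: its orbit point is within [e / 2]
     of [p], hence within [5 / 8 * e] of that of [x]. *)
  move=> /hagree/(_ (Ordinal lt_in) true false).
  rewrite /sign_word /= /f jE.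
  rewrite ifF; last by apply/negP; rewrite /a; lra.
  rewrite ifT; last by rewrite /a; lra.
  move=> /(_ erefl); case: ifP => [_ /(_ erefl) //|/negbT]; rewrite -ltNge => py _.
  have := metric_triangle (iter i T x) p (iter i T y).
  rewrite (metric_sym _ p); move: py; rewrite /a; lra.
have : (size s <= \prod_j #|A j|)%N.
  have -> : (\prod_j #|A j| = #|family (fun j => mem (A j))|)%N.
    by rewrite card_family foldrE big_map big_enum.
  rewrite -(size_map code) cardE uniq_leq_size //.
    by rewrite map_inj_in_uniq.
  move=> _ /mapP[x _ ->]; rewrite mem_enum; apply/familyP => j.
  by rewrite ffunE; have [_ + _] := hE j.
rewrite -(ler_nat R) natr_prod => /le_trans; apply.
apply: (@le_trans _ _ (\prod_(j < m) expR (eta * n%:R))).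
  by apply: ler_prod => j _; rewrite ler0n; have [-> _ _] := hE j.
rewrite prodr_const card_ord -expRM_natl ler_expR mulrA ler_wpM2r //.
rewrite /eta mulrCA -[leRHS]mulr1 ler_pM2l // ler_pdivrMr ?ltr0n // mul1r.
by rewrite ler_nat.
Qed.

Lemma entropy_at_scale_le (e delta : R) : 0 < e -> 0 < delta ->
  (entropy_at_scale T e <= delta%:E)%E.
Proof.
move=> e0 delta0; have [n0 hn0] := size_bowen_separated e0 delta0.
pose u n := ((n%:R^-1)%:E * lne (separation_number T n e))%E.
(* The limsup is at most the supremum over a tail; starting at [n0.+1] keeps [n] positive. *)
apply: (@le_trans _ _ (ereal_sup (u @` [set n | (n0.+1 <= n)%N]))).
  apply: ereal_inf_lbound; exists [set n | (n0.+1 <= n)%N] => //.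
  exact: nbhs_infty_ge.
apply: ge_ereal_sup => _ [n /= n0n <-]; rewrite /u.
have n0R : 0 < n%:R :> R by rewrite ltr0n (leq_trans _ n0n).
have sep_le : (separation_number T n e <= (expR (delta * n%:R))%:E)%E.
  apply: ge_ereal_sup => _ [s hs <-]; rewrite lee_fin.
  by apply: hn0 hs; exact: ltnW.
have sep_ge : (0 <= separation_number T n e)%E.
  by apply: ereal_sup_ubound; exists nil.
have : (lne (separation_number T n e) <= (delta * n%:R)%:E)%E.
  rewrite -(expRK (delta * n%:R)) -lne_EFin ?expR_gt0 // lee_lne //.
    by rewrite in_itv /= sep_ge leey.
  by rewrite in_itv /= lee_fin expR_ge0 leey.
have inv0 : (0 <= (n%:R^-1)%:E :> \bar R)%E by rewrite lee_fin invr_ge0 ltW.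
move=> /(lee_wpmul2l inv0).
by move=> /le_trans; apply; rewrite -EFinM lee_fin mulrC mulfK // gt_eqF.
Qed.

End entropy.

Theorem corollary15 (R : realType) (hchowla : chowla R)
    (X : metricType R) (hX : compact [set: X])
    (T : X -> X) (hT : continuous T)
    (hent : (0 < topological_entropy T)%E) :
  ~ strong_MOMO_liouville T.
Proof.
move=> hM; move: hent; rewrite ltNge => /negP; apply.
apply: ge_ereal_sup => _ [e /= e0 <-].
apply/lee_addgt0Pr => delta delta0; rewrite add0e.
exact: entropy_at_scale_le.
Qed.
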